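(* Let $d\ge1$ and let $\mathcal{F}=\{f_i(x)=T_ix+t_i\}_{i=1}^m$ be a finite family of contractive affine maps of $\mathbb{R}^d$, where each $T_i$ is a non-singular linear map and $t_i\in\mathbb{R}^d$. Suppose $\mathcal{F}$ satisfies the open set condition with holes (OSCH). Let $\Lambda$ be the attractor of $\mathcal{F}$. Then $\Lambda$ is thin for isotropic doubling measures, i.e. $\mu(\Lambda)=0$ for every isotropic doubling measure $\mu$ on $\mathbb{R}^d$.
   Context: The attractor (self-affine set) of $\mathcal{F}$ is the unique nonempty compact set $\Lambda\subset\mathbb{R}^d$ with $\Lambda=\bigcup_{i=1}^m f_i(\Lambda)$. The family $\mathcal{F}$ satisfies the open set condition (OSC) if there is a nonempty open set $V\subset\mathbb{R}^d$ such that $f_i(V)\subset V$ for all $1\le i\le m$ and $f_i(V)\cap f_j(V)=\emptyset$ for all $i\ne j$. It satisfies the OSCH if it satisfies the OSC with an open set $V$ for which $V\setminus\bigcup_{i=1}^m f_i(V)$ has nonempty interior. A rectangular box in $\mathbb{R}^d$ is an isometric image (arbitrary orientation allowed) of a product $\prod_{i=1}^d[0,\ell_i]$ with all $\ell_i>0$. A Borel measure $\mu$ on $\mathbb{R}^d$ is isotropic doubling if there is a constant $A\ge 1$ such that $A^{-1}\le \mu(R_1)/\mu(R_2)\le A$ whenever $R_1$ and $R_2$ are congruent rectangular boxes with nonempty intersection; it is understood that $0<\mu(R)<\infty$ for every rectangular box $R$. *)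

(* Defs.v *)
From mathcomp Require Import all_boot all_order all_algebra.
From mathcomp Require Import all_classical all_reals all_analysis.
Import Order.TTheory GRing.Theory Num.Theory.
Import numFieldNormedType.Exports.

Set Implicit Arguments.
Unset Strict Implicit.
Unset Printing Implicit Defensive.

Local Open Scope classical_set_scope.
Local Open Scope ring_scope.

(* R^d is 'rV[R]_d.  The library norm `|x| on 'rV[R]_d is the sup norm: it
   induces the usual topology, but isometries (hence boxes and congruence) and
   contractions below refer to the Euclidean norm. *)
Definition eucl_norm (R : realType) (d : nat) (x : 'rV[R]_d) : R :=
  Num.sqrt (\sum_i x ord0 i ^+ 2).

Definition contractive (R : realType) (d : nat)
    (f : 'rV[R]_d -> 'rV[R]_d) : Prop :=
  exists2 c : R, 0 <= c < 1 &
    forall x y, eucl_norm (f x - f y) <= c * eucl_norm (x - y).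

Definition euclidean_isometry (R : realType) (d : nat)
    (g : 'rV[R]_d -> 'rV[R]_d) : Prop :=
  forall x y, eucl_norm (g x - g y) = eucl_norm (x - y).

(* Vectors are rows, so linear maps act by right multiplication. *)
Definition affine_map (R : realType) (d : nat) (T : 'M[R]_d) (t : 'rV[R]_d) :
    'rV[R]_d -> 'rV[R]_d :=
  fun x => x *m T + t.

Definition is_attractor (R : realType) (d m : nat)
    (f : 'I_m -> 'rV[R]_d -> 'rV[R]_d) (L : set 'rV[R]_d) : Prop :=
  [/\ L !=set0, compact L & L = \bigcup_i (f i @` L)].

Definition osc_open_set (R : realType) (d m : nat)
    (f : 'I_m -> 'rV[R]_d -> 'rV[R]_d) (V : set 'rV[R]_d) : Prop :=
  [/\ V !=set0, open V, forall i, f i @` V `<=` V &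
      forall i j, i != j -> f i @` V `&` f j @` V = set0].

Definition osch (R : realType) (d m : nat)
    (f : 'I_m -> 'rV[R]_d -> 'rV[R]_d) : Prop :=
  exists V, osc_open_set f V /\ interior (V `\` \bigcup_i (f i @` V)) !=set0.

Definition std_box (R : realType) (d : nat) (l : 'I_d -> R) :
    set 'rV[R]_d :=
  [set x | forall i, 0 <= x ord0 i <= l i].

Definition rectangular_box (R : realType) (d : nat) (B : set 'rV[R]_d) : Prop :=
  exists (g : 'rV[R]_d -> 'rV[R]_d) (l : 'I_d -> R),
    [/\ euclidean_isometry g, forall i, 0 < l i & B = g @` std_box l].

Definition congruent (R : realType) (d : nat) (B1 B2 : set 'rV[R]_d) : Prop :=
  exists2 g : 'rV[R]_d -> 'rV[R]_d, euclidean_isometry g & B2 = g @` B1.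

Notation borel_rV R d := (g_sigma_algebraType (@open 'rV[R]_d)).

Definition isotropic_doubling (R : realType) (d : nat)
    (mu : {measure set (borel_rV R d) -> \bar R}) : Prop :=
  (forall B : set 'rV[R]_d, rectangular_box B -> (0 < mu B < +oo)%E) /\
  exists2 A : R, 1 <= A &
    forall B1 B2 : set 'rV[R]_d,
      rectangular_box B1 -> rectangular_box B2 -> congruent B1 B2 ->
      B1 `&` B2 !=set0 ->
      A^-1 <= fine (mu B1) / fine (mu B2) <= A.

Definition thin_for_isotropic_doubling (R : realType) (d : nat)
    (L : set 'rV[R]_d) : Prop :=
  forall mu : {measure set (borel_rV R d) -> \bar R},
    isotropic_doubling mu -> mu L = 0%E.

(* Main.v *)
Require Import Defs.
From mathcomp Require Import all_boot all_order all_algebra perm.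
From mathcomp Require Import all_classical all_reals all_analysis.
From mathcomp Require Import ring lra.
Import Order.TTheory GRing.Theory Num.Theory.
Import numFieldNormedType.Exports.
Set Implicit Arguments.
Unset Strict Implicit.
Unset Printing Implicit Defensive.
Local Open Scope classical_set_scope.
Local Open Scope ring_scope.

(** The attractor is null because every scale contributes a definite share of
    mass, disjoint from that of all other scales, inside one bounded region.

    Let [B] be a ball in the hole [V `\` \bigcup_i f_i V].  For words [w <> w']
    in the alphabet of the maps, the copies [f_w B] and [f_w' B] are disjoint:
    incomparable words are separated by the open set condition, and when [w]
    is a proper prefix of [w'] the copy [f_w' B] lies in [f_w] of some [f_i V],
    which avoids [f_w B] ([word_map_disjoint]).  All these copies stay in one
    bounded set, since a large Euclidean ball is mapped into itself by every
    [f_i] ([contractive_family_invariant_ball]).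

    The crux is a comparison [mu (f_w K) <= C * mu (f_w B)] with [K] compact
    and [C] independent of [w], although [f_w] may distort shapes arbitrarily
    ([measure_affine_image_le]).  A pivoted triangular factorization
    ([pivoted_lq]) writes the linear part of [f_w] as [P *m diag_mx D *m Q]
    with [Q] orthogonal, [D] positive, and the entries of [P] and of its
    inverse bounded in terms of the dimension alone.  So [f_w B] contains a box
    with frame [Q] and sides [e * D_i], and [f_w K] lies in a box with the same
    frame and half-sides [N * e * D_i], with [e] and [N] independent of [w].
    The large box is covered by a bounded number of translates of the small
    one, each reached from it by [N] moves between intersecting
    translates, every one of which costs a factor [A] ([doubling_cover]).

    Applying this with [K] the attractor [L] and summing over the words of
    length [n] gives [mu L <= C * mu (E n)], where [E n] is the union of the
    [f_w B] with [w] of length [n].  The sets [E n] are disjoint in a set of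
    finite measure, so [mu L = 0] ([measure0_of_disjoint_copies]). *)

(** * A triangular factorization with bounded factors *)

Section LinearAlgebra.
Variable R : rcfType.

Definition sqnorm n (x : 'rV[R]_n) : R := \sum_i x ord0 i ^+ 2.

Lemma sqnormE n (x : 'rV[R]_n) : x *m x^T = (sqnorm x)%:M.
Proof.
apply/matrixP => i j; rewrite !ord1 !mxE eqxx mulr1n.
by apply: eq_bigr => k _; rewrite mxE expr2.
Qed.

Lemma sqnorm_ge0 n (x : 'rV[R]_n) : 0 <= sqnorm x.
Proof. by apply: sumr_ge0 => i _; rewrite sqr_ge0. Qed.

Lemma sqnorm_coord n (x : 'rV[R]_n) i : x ord0 i ^+ 2 <= sqnorm x.
Proof.
rewrite /sqnorm (bigD1 i) //= lerDl; apply: sumr_ge0 => j _; exact: sqr_ge0.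
Qed.

Lemma sqnorm_eq0 n (x : 'rV[R]_n) : sqnorm x = 0 -> x = 0.
Proof.
move=> x0; apply/rowP => i; rewrite mxE; apply/eqP.
by rewrite -sqrf_eq0 eq_le sqr_ge0 -x0 sqnorm_coord.
Qed.

Lemma sqnorm_orthogonal n (x : 'rV[R]_n) (Q : 'M[R]_n) :
  Q *m Q^T = 1%:M -> sqnorm (x *m Q) = sqnorm x.
Proof.
move=> QQ; have := sqnormE (x *m Q).
rewrite trmx_mul mulmxA -(mulmxA x) QQ mulmx1 sqnormE.
by move/matrixP => /(_ 0 0); rewrite !mxE.
Qed.

(** The reflection in the hyperplane orthogonal to [v - |v| e_0] exchanges [v]
    and [|v| e_0], because these two vectors have the same length.
    If they coincide, the identity does. *)
Lemma householder n (v : 'rV[R]_(1 + n)) :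
  exists2 Q : 'M[R]_(1 + n), Q *m Q^T = 1%:M &
    v *m Q = Num.sqrt (sqnorm v) *: delta_mx 0 0.
Proof.
set s := Num.sqrt _; set e : 'rV[R]_(1 + n) := delta_mx 0 0.
pose u := v - s *: e.
have s2 : s ^+ 2 = sqnorm v by rewrite sqr_sqrtr // sqnorm_ge0.
have [u0|u0] := eqVneq u 0.
  exists 1%:M; first by rewrite trmx1 mulmx1.
  by rewrite mulmx1; apply/eqP; rewrite -subr_eq0 -/u u0.
pose a := sqnorm u.
have a0 : a != 0 by apply: contra_neq u0 => /sqnorm_eq0.
have vu : v *m u^T = (a / 2)%:M.
  have vv := sqnormE v; have uu := sqnormE u.
  have ve : v *m e^T = (v 0 0)%:M.
    rewrite trmx_delta -colE; apply/matrixP => i j.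
    by rewrite !ord1 !mxE eqxx mulr1n.
  have ev : e *m v^T = (v 0 0)%:M.
    by apply: trmx_inj; rewrite trmx_mul trmxK ve tr_scalar_mx.
  have ee : e *m e^T = 1%:M.
    rewrite trmx_delta mul_delta_mx; apply/matrixP => i j.
    by rewrite !ord1 !mxE.
  have vu1 : v *m u^T = (sqnorm v - s * v 0 0)%:M.
    by rewrite /u linearB /= linearZ /= mulmxBr -scalemxAr vv ve
       scale_scalar_mx -raddfB.
  have eu1 : e *m u^T = (v 0 0 - s)%:M.
    by rewrite /u linearB /= linearZ /= mulmxBr -scalemxAr ev ee
       scale_scalar_mx -raddfB mulr1.
  rewrite vu1; congr (_%:M).
  have : a%:M = v *m u^T - s *: (e *m u^T) by rewrite -uu scalemxAl -mulmxBl.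
  rewrite vu1 eu1 scale_scalar_mx -raddfB.
  move/matrixP => /(_ 0 0); rewrite !mxE !mulr1n => ->.
  by rewrite -s2; field.
have {s2} vE : v - u = s *: e by rewrite /u opprB addrC subrK.
clearbody u; rewrite -{}vE.
exists (1%:M - (2 / a) *: (u^T *m u)).
  have -> : (1%:M - (2 / a) *: (u^T *m u))^T = 1%:M - (2 / a) *: (u^T *m u).
    by rewrite linearB /= linearZ /= trmx1 trmx_mul trmxK.
  rewrite mulmxBl mul1mx mulmxBr mulmx1 -scalemxAl -scalemxAr mulmxA
    -(mulmxA u^T) sqnormE -/a mul_mx_scalar -scalemxAl !scalerA opprB.
  have -> : 2 / a * (2 / a * a) = 2 / a + 2 / a by field.
  by rewrite scalerDl addrK subrK.
rewrite mulmxBr mulmx1 -scalemxAr mulmxA vu mul_scalar_mx scalerA.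
have -> : 2 / a * (a / 2) = 1 by field.
by rewrite scale1r.
Qed.

(** A rough singular value decomposition: [D] and [Q] describe the shape of
    the image of a ball under [T] up to a factor depending on [n] only, as [K]
    and its inverse have bounded entries (see [invmx_le_fact]).  Gram-Schmidt
    on the rows gives a triangular matrix times an orthogonal one; taking the
    longest remaining row first keeps each entry below the pivot of its column,
    so that dividing column [i] by the pivot [D i] leaves entries at most [1]
    and a unit triangular matrix up to row exchanges. *)
Lemma pivoted_lq n (T : 'M[R]_n) : T \in unitmx ->
  exists (K : 'M[R]_n) (D : 'rV[R]_n) (Q : 'M[R]_n),
  [/\ T = K *m diag_mx D *m Q, Q *m Q^T = 1%:M, forall i, 0 < D 0 i,
      forall i j, `|K i j| <= 1 & `|\det K| = 1].
Proof.
elim: n T => [T _|n IH].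
  exists 1%:M, 0, 1%:M; split; try by case.
  - by rewrite [T]flatmx0 [RHS]flatmx0.
  - by rewrite trmx1 mulmx1.
  - by rewrite det1 normr1.
rewrite -[n.+1]/(1 + n)%N => T Tunit.
(* The pivot is the longest row; it is moved to the top. *)
have [i0 _ i0max] :=
  arg_maxP (fun i => sqnorm (row i T)) (erefl : xpredT (0 : 'I_(1 + n))).
pose P : 'M[R]_(1 + n) := tperm_mx 0 i0.
have PP : P *m P = 1%:M by rewrite /P -perm_mxM tperm2 perm_mx1.
have rowP i : row i (P *m T) = row (tperm 0 i0 i) T.
  by apply/matrixP => k j; rewrite -xrowE !mxE.
have [Q1 Q1o vQ] := householder (row 0 (P *m T)).
set s := Num.sqrt _ in vQ.
have s2 : s ^+ 2 = sqnorm (row i0 T).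
  by rewrite sqr_sqrtr ?sqnorm_ge0// rowP tpermL.
have sge0 : 0 <= s by exact: sqrtr_ge0.
pose M : 'M[R]_(1 + n) := P *m T *m Q1.
have Munit : M \in unitmx.
  by rewrite !unitmx_mul Tunit (mulmx1_unit PP).1 (mulmx1_unit Q1o).1.
have Mul : ulsubmx M = s%:M.
  apply/matrixP => i j; rewrite !ord1 !mxE !lshift0 eqxx mulr1n.
  have := congr1 (fun x : 'rV_(1 + n) => x 0 0) vQ.
  by rewrite -row_mul !mxE !eqxx mulr1 => ->.
have Mur : ursubmx M = 0.
  apply/matrixP => i j; rewrite !ord1 !mxE !lshift0.
  have := congr1 (fun x : 'rV_(1 + n) => x 0 (rshift 1 j)) vQ.
  by rewrite -row_mul !mxE /= mulr0 => ->.
(* An orthogonal factor preserves row lengths, and no row is longer than the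
   pivot. *)
have Mle i : `|M i 0| <= s.
  rewrite -ler_sqr ?nnegrE// real_normK ?num_real//.
  apply: (le_trans (y := sqnorm (row i M))).
    by have := sqnorm_coord (row i M) 0; rewrite mxE.
  by rewrite row_mul sqnorm_orthogonal// rowP s2; apply: i0max.
have ME : M = block_mx s%:M 0 (dlsubmx M) (drsubmx M).
  by rewrite -Mul -Mur submxK.
have detM : \det M = s * \det (drsubmx M).
  by rewrite {1}ME det_lblock det_scalar1.
have := Munit; rewrite unitmxE detM unitfE mulf_eq0 negb_or => /andP[s0 dr0].
have sgt0 : 0 < s by rewrite lt_def s0.
have [|K [D [Q [EM Qo Dpos Kle Kdet]]]] := IH (drsubmx M).
  by rewrite unitmxE unitfE.
pose K1 : 'M[R]_(1 + n) := block_mx 1%:M 0 (s^-1 *: dlsubmx M) K.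
have K1le i j : `|K1 i j| <= 1.
  rewrite /K1 /block_mx mxE;
  case: splitP => k _; rewrite mxE; case: splitP => l _.
  - by rewrite !ord1 mxE normr1.
  - by rewrite mxE normr0.
  - have dlE : dlsubmx M k l = M (rshift 1 k) 0.
      by rewrite ord1 [LHS]mxE [LHS]mxE lshift0.
    rewrite mxE dlE normrM gtr0_norm ?invr_gt0//.
    by rewrite mulrC ler_pdivrMr// mul1r.
  - exact: Kle.
exists (P *m K1), (row_mx s%:M D), (block_mx 1%:M 0 0 Q *m Q1^T); split.
- rewrite !mulmxA.
  have -> : P *m K1 *m diag_mx (row_mx s%:M D) *m block_mx 1%:M 0 0 Q = P *m M.
    rewrite -!mulmxA; congr (P *m _); rewrite diag_mx_row /K1.
    have -> : diag_mx s%:M = s%:M :> 'M[R]_1.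
      by apply/matrixP => i j; rewrite !ord1 !mxE.
    rewrite mulmx_block !(mul0mx, mulmx0, mul1mx, mulmx1, addr0, add0r).
    rewrite mulmx_block !(mul0mx, mulmx0, mul1mx, mulmx1, addr0, add0r).
    by rewrite [M in RHS]ME mul_mx_scalar scalerA mulfV ?scale1r// EM !mulmxA.
  by rewrite /M !mulmxA PP mul1mx -mulmxA Q1o mulmx1.
- rewrite trmx_mul trmxK mulmxA -(mulmxA _ Q1^T).
  rewrite (mulmx1C Q1o) mulmx1 tr_block_mx mulmx_block.
  rewrite !trmx0 trmx1 !(mul0mx, mulmx0, mul1mx, mulmx1, addr0, add0r) Qo.
  by rewrite -scalar_mx_block.
- move=> i; rewrite mxE; case: splitP => j _; last exact: Dpos.
  by rewrite ord1 mxE eqxx mulr1n.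
- by move=> i j; rewrite -xrowE [X in `|X|]mxE.
- rewrite det_mulmx normrM det_perm normr_sign mul1r.
  by rewrite /K1 det_lblock det1 mul1r.
Qed.

Lemma det_le_fact n (A : 'M[R]_n) :
  (forall i j, `|A i j| <= 1) -> `|\det A| <= n`!%:R.
Proof.
move=> A1; rewrite /determinant (le_trans (ler_norm_sum _ _ _))//.
rewrite -card_Sn -sum1_card natr_sum ler_sum// => s _.
rewrite normrM normr_sign mul1r normr_prod.
by apply: prodr_ile1 => i _; rewrite normr_ge0 A1.
Qed.

(** The inverse is the adjugate up to sign, and its entries are minors, that
    is, signed sums of [n.-1`!] products of entries. *)
Lemma invmx_le_fact n (A : 'M[R]_n) i j :
  (forall i j, `|A i j| <= 1) -> `|\det A| = 1 -> `|invmx A i j| <= n.-1`!%:R.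
Proof.
move=> A1 detA; have Au : A \in unitmx.
  by rewrite unitmxE unitfE -normr_eq0 detA oner_neq0.
rewrite /invmx Au !mxE normrM normfV detA invr1 mul1r /cofactor.
rewrite normrM normr_sign mul1r.
by apply: det_le_fact => k l; rewrite !mxE.
Qed.

End LinearAlgebra.

(** * Affine maps and Borel sets *)

Section AffineTopology.
Variables (R : realType) (d : nat).
Implicit Types (A Q : 'M[R]_d) (c : 'rV[R]_d).

(** The filter is kept abstract so that the limit rules for sums and products
    apply to it. *)
Lemma affine_map_coord_cvg (F : set_system 'rV[R]_d) A c (x : 'rV[R]_d) j :
  Filter F ->
  (forall k, (fun y : 'rV[R]_d => y ord0 k) @ F --> x ord0 k) ->
  (fun y => affine_map A c y ord0 j) @ F --> affine_map A c x ord0 j.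
Proof.
move=> FF Fx.
have -> : (fun y => affine_map A c y ord0 j) =
          (fun y => \sum_k y ord0 k * A k j + c ord0 j).
  by apply/funext => y; rewrite !mxE.
rewrite !mxE; apply: cvgD; last exact: cvg_cst.
elim: (index_enum _) => [|k s IH].
  rewrite big_nil; under eq_fun do rewrite big_nil; exact: cvg_cst.
rewrite big_cons; under eq_fun do rewrite big_cons.
by apply: cvgD IH; apply: cvgM (cvg_cst _); exact: Fx.
Qed.

Lemma affine_map_continuous A c : continuous (affine_map A c).
Proof.
move=> x B /nbhs_ballP[e e0 eB].
suff : \forall y \near x, forall j,
    ball (affine_map A c x ord0 j) e (affine_map A c y ord0 j).
  apply: filterS => y yP; apply: eB; split => // i j.
  by rewrite ord1.
apply: (@filter_forall _ _ (fun j y =>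
  ball (affine_map A c x ord0 j) e (affine_map A c y ord0 j))
  _ (nbhs_filter x)) => j.
apply: (@affine_map_coord_cvg (nbhs x) A c x j (nbhs_filter x)
  (fun k => @coord_continuous _ _ _ ord0 k x)).
exact: nbhsx_ballx.
Qed.

Lemma affine_mapK A c : A \in unitmx ->
  cancel (affine_map A c) (affine_map (invmx A) (- (c *m invmx A))).
Proof. by move=> Au x; rewrite /affine_map mulmxDl mulmxK// addrK. Qed.

Lemma affine_mapVK A c : A \in unitmx ->
  cancel (affine_map (invmx A) (- (c *m invmx A))) (affine_map A c).
Proof. by move=> Au x; rewrite /affine_map mulmxBl !mulmxKV// subrK. Qed.

Lemma image_affine_map A c (S : set 'rV[R]_d) : A \in unitmx ->
  affine_map A c @` S = affine_map (invmx A) (- (c *m invmx A)) @^-1` S.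
Proof.
move=> Au; apply/seteqP; split => [_ [x Sx <-]|x Sx] /=.
  by rewrite affine_mapK.
exists (affine_map (invmx A) (- (c *m invmx A)) x) => //.
by rewrite affine_mapVK.
Qed.

Lemma affine_map_open A c (S : set 'rV[R]_d) : A \in unitmx -> open S ->
  open (affine_map A c @` S).
Proof.
move=> Au oS; rewrite image_affine_map//; apply: open_comp => // x _.
exact: affine_map_continuous.
Qed.

Lemma affine_map_compact A c (S : set 'rV[R]_d) : compact S ->
  compact (affine_map A c @` S).
Proof.
apply: continuous_compact; apply: continuous_subspaceT.
exact: affine_map_continuous.
Qed.

Lemma measurable_open (S : set 'rV[R]_d) :
  open S -> measurable (S : set (borel_rV R d)).
Proof. exact: sub_sigma_algebra. Qed.

Lemma measurable_compact (S : set 'rV[R]_d) :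
  compact S -> measurable (S : set (borel_rV R d)).
Proof.
move=> cS; rewrite -[S]setCK; apply: measurableC; apply: measurable_open.
apply: closed_openC; apply: compact_closed => //; exact: norm_hausdorff.
Qed.

Lemma coordinate_box_compact (a b : 'I_d -> R) :
  compact [set x : 'rV[R]_d | forall i, a i <= x ord0 i <= b i].
Proof.
have -> : [set x : 'rV[R]_d | forall i, a i <= x ord0 i <= b i] =
    [set x | forall i, [set` `[a i, b i]] (x ord0 i)].
  by apply/seteqP; split=> x /= xP i; have := xP i; rewrite in_itv.
apply: (@rV_compact R d (fun i => [set` `[a i, b i]])) => i.
exact: segment_compact.
Qed.

End AffineTopology.

(** * Finite unions *)

Section FiniteUnions.
Context d (T : measurableType d) (R : realType).
Variables (mu : {measure set T -> \bar R}) (I : finType).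
Implicit Type F : I -> set T.

Lemma fsum_setT (h : I -> \bar R) : (\sum_(i \in setT) h i = \sum_i h i)%E.
Proof.
rewrite (fsbigE (index_enum I)) ?index_enum_uniq//= => [|i _].
  by rewrite big_mkcond /=; under eq_bigr do rewrite in_setT.
by rewrite mem_index_enum.
Qed.

Lemma measure_le_fin F S : (forall i, measurable (F i)) -> measurable S ->
  S `<=` \bigcup_i F i -> (mu S <= \sum_i mu (F i))%E.
Proof.
move=> mF mS SF; rewrite -fsum_setT.
exact: content_sub_fsum finite_finset _ _ SF.
Qed.

Lemma measure_eq_fin F : (forall i, measurable (F i)) -> trivIset setT F ->
  mu (\bigcup_i F i) = (\sum_i mu (F i))%E.
Proof.
by move=> mF tF; rewrite (measure_fin_bigcup _ finite_finset)// fsum_setT.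
Qed.

End FiniteUnions.

(** * Boxes with a common frame and doubling measures *)

Section Boxes.
Variables (R : realType) (d : nat).
Variables (Q : 'M[R]_d) (l : 'I_d -> R).
Hypotheses (Qo : Q *m Q^T = 1%:M) (l_gt0 : forall i, 0 < l i).
Implicit Types (c v : 'rV[R]_d).

Definition framed_box c : set 'rV[R]_d := affine_map Q c @` std_box l.

Lemma orthogonal_isometry c : euclidean_isometry (affine_map Q c).
Proof.
move=> x y; rewrite /affine_map opprD addrACA subrr addr0 -mulmxBl.
by congr Num.sqrt; exact: sqnorm_orthogonal.
Qed.

Lemma translation_isometry c : euclidean_isometry (fun x => x + c).
Proof. by move=> x y; rewrite opprD addrACA subrr addr0. Qed.

Lemma framed_box_rectangular c : rectangular_box (framed_box c).
Proof.
by exists (affine_map Q c), l; split => //; exact: orthogonal_isometry.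
Qed.

Lemma framed_box_congruent c c' : congruent (framed_box c) (framed_box c').
Proof.
exists (fun x => x + (c' - c)); first exact: translation_isometry.
rewrite /framed_box image_comp.
have -> // : affine_map Q c' = (fun x => x + (c' - c)) \o affine_map Q c.
by apply/funext => x /=; rewrite /affine_map addrACA subrr addr0 addrC.
Qed.

Lemma framed_box_compact c : compact (framed_box c).
Proof. exact/affine_map_compact/coordinate_box_compact. Qed.

(** Coordinatewise, [[0, l_i]] meets its translate by [v_i] as soon as
    [|v_i| <= l_i]. *)
Lemma framed_box_meet c v : (forall i, `|v ord0 i| <= l i) ->
  framed_box (c + v *m Q) `&` framed_box c !=set0.
Proof.
move=> vl; pose y : 'rV[R]_d := \row_i Num.max 0 (v ord0 i).
exists (affine_map Q c y); split; last first.
  exists y => // i; rewrite mxE le_max lexx /= ge_max ltW//=.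
  exact: le_trans (ler_norm _) (vl i).
exists (y - v); last by rewrite /affine_map mulmxBl [c + _]addrC addrA subrK.
move=> i; rewrite !mxE subr_ge0 le_max lexx orbT /= lerBlDr ge_max.
have := vl i; have := l_gt0 i; rewrite ler_norml => ? /andP[? ?].
by apply/andP; split; lra.
Qed.

Section Doubling.
Variables (mu : {measure set (borel_rV R d) -> \bar R}) (A : R).
Hypothesis A1 : 1 <= A.
Hypothesis mu_fin : forall B : set 'rV[R]_d,
  rectangular_box B -> (0 < mu B < +oo)%E.
Hypothesis mu_dbl : forall B1 B2 : set 'rV[R]_d,
      rectangular_box B1 -> rectangular_box B2 -> congruent B1 B2 ->
      B1 `&` B2 !=set0 ->
      A^-1 <= fine (mu B1) / fine (mu B2) <= A.

Lemma doubling_step c v : (forall i, `|v ord0 i| <= l i) ->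
  (mu (framed_box (c + v *m Q)) <= A%:E * mu (framed_box c))%E.
Proof.
move=> vl; set B1 := framed_box _; set B2 := framed_box c.
have r1 : rectangular_box B1 by exact: framed_box_rectangular.
have r2 : rectangular_box B2 by exact: framed_box_rectangular.
have := mu_dbl r1 r2 (framed_box_congruent _ _) (framed_box_meet c vl).
have /andP[g1 f1] := mu_fin r1; have /andP[g2 f2] := mu_fin r2.
have fn1 : mu B1 \is a fin_num by rewrite ge0_fin_numE// ltW.
have fn2 : mu B2 \is a fin_num by rewrite ge0_fin_numE// ltW.
have fine_gt : 0 < fine (mu B2) by rewrite fine_gt0// g2.
rewrite -(fineK fn1) -(fineK fn2) -EFinM lee_fin.
by rewrite ler_pdivrMr// => /andP[].
Qed.

Lemma doubling_chain n c v : (forall i, `|v ord0 i| <= l i) ->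
  (mu (framed_box (c + (v *+ n) *m Q)) <= (A ^+ n)%:E * mu (framed_box c))%E.
Proof.
move=> vl; elim: n => [|n IH]; first by rewrite mulr0n mul0mx addr0 expr0 mul1e.
rewrite mulrSr mulmxDl addrA (le_trans (doubling_step _ vl))//.
by rewrite exprS EFinM -muleA lee_wpmul2l// lee_fin (le_trans ler01).
Qed.

(** The large box is cut along the grid of the small one.  A grid translate
    has coordinates [(k_i - N) * l_i] with [0 <= k_i <= N + N], hence is reached
    from the small box in [N] equal moves of at most [l_i] along each axis, so
    [doubling_chain] applies. *)
Lemma doubling_cover N c (S : set 'rV[R]_d) :
  (0 < N)%N -> measurable (S : set (borel_rV R d)) ->
  S `<=` affine_map Q c @`
    [set y : 'rV[R]_d | forall i, `|y ord0 i| <= N%:R * l i] ->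
  (mu S <= (#|{ffun 'I_d -> 'I_(N + N).+1}|%:R * A ^+ N)%:E *
   mu (framed_box c))%E.
Proof.
move=> N0 mS SN; have N0R : 0 < N%:R :> R by rewrite ltr0n.
have l0 i : 0 <= l i by exact: ltW.
pose v (k : {ffun 'I_d -> 'I_(N + N).+1}) : 'rV[R]_d :=
  \row_i (((k i)%:R - N%:R) / N%:R * l i).
have vl k i : `|v k ord0 i| <= l i.
  rewrite mxE normrM (gtr0_norm (l_gt0 i)) ler_piMl//.
  rewrite normf_div normr_nat ler_pdivrMr// mul1r ler_norml.
  rewrite lerBrDl subrr ler0n /=.
  by rewrite lerBlDr -natrD ler_nat -ltnS ltn_ord.
have mbox k :
    measurable (framed_box (c + (v k *+ N) *m Q) : set (borel_rV R d)).
  apply: measurable_compact; exact: framed_box_compact.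
apply: le_trans (measure_le_fin mu mbox mS _) _.
  move=> _ /SN[y yN <-].
  pose z i := y ord0 i / l i + N%:R.
  have z0 i : 0 <= z i.
    rewrite /z -lerBlDr sub0r ler_pdivlMr// mulNr.
    by have := yN i; rewrite ler_norml => /andP[].
  have zN i : (Num.truncn (z i) < (N + N).+1)%N.
    rewrite truncn_lt_nat// (le_lt_trans (y := (N + N)%:R)) ?ltr_nat//.
    rewrite natrD lerD2r ler_pdivrMr//.
    by have := yN i; rewrite ler_norml => /andP[].
  exists [ffun i => Ordinal (zN i)] => //.
  set k := finfun _; exists (y - v k *+ N); last first.
    by rewrite /affine_map mulmxBl [c + _]addrC addrA subrK.
  move=> i; rewrite !mxE mulmxnE mxE ffunE /=.
  have /andP[lo hi] := truncn_itv (z0 i).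
  rewrite -mulrnAl -[_ / _ *+ _]mulr_natr divfK ?gt_eqF//.
  have yE : y ord0 i = (z i - N%:R) * l i by rewrite /z addrK divfK ?gt_eqF.
  rewrite yE -mulrBl opprB addrA subrK.
  rewrite mulr_ge0 ?subr_ge0//= ler_piMl//.
  by rewrite ltW// ltrBlDl natr1.
apply: (@le_trans _ _ (\sum_(k : {ffun 'I_d -> 'I_(N + N).+1})
    (A ^+ N)%:E * mu (framed_box c))%E).
  by apply: lee_sum => k _; exact: doubling_chain.
have /andP[mu0 muoo] := mu_fin (framed_box_rectangular c).
have fn : mu (framed_box c) \is a fin_num by rewrite ge0_fin_numE// ltW.
by rewrite -(fineK fn) -!EFinM sumEFin sumr_const -mulrA mulr_natl.
Qed.
End Doubling.
End Boxes.

(** * Copies of a set under words *)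

Section Words.
Variables (T : Type) (m : nat) (f : 'I_m -> T -> T).

Fixpoint word_map (w : seq 'I_m) : T -> T :=
  if w is i :: w' then f i \o word_map w' else id.

Lemma word_map_stable (V : set T) w :
  (forall i, f i @` V `<=` V) -> word_map w @` V `<=` V.
Proof.
move=> fV; elim: w => [|i w IH] _ [x Vx <-] //=.
by apply: (fV i); exists (word_map w x) => //; apply: IH; exists x.
Qed.

(** If exactly one word is empty, the two points lie in [B] and in some
    [f i @` V]; if the first letters differ, in disjoint images of [V]; if they
    agree, they cancel by injectivity. *)
Lemma word_map_disjoint (B V : set T) w w' :
  (forall i, injective (f i)) -> (forall i, f i @` V `<=` V) ->
  (forall i j, i != j -> f i @` V `&` f j @` V = set0) ->
  B `<=` V -> (forall i, B `&` f i @` V = set0) ->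
  word_map w @` B `&` word_map w' @` B !=set0 -> w = w'.
Proof.
move=> finj fV Vdisj BV Bhole.
have inV u x : B x -> V (word_map u x).
  by move=> Bx; apply: (word_map_stable fV); exists x => //; exact: BV.
elim: w w' => [|i w IH] [|j w'] //= [_ [[x Bx <-] [y By xy]]].
- have : (B `&` f j @` V) x.
    by split => //; rewrite -xy; exists (word_map w' y) => //; exact: inV.
  by rewrite Bhole.
- have : (B `&` f i @` V) y.
    by split => //; rewrite [y]xy; exists (word_map w x) => //; exact: inV.
  by rewrite Bhole.
- have [ij|ij] := eqVneq i j; last first.
    have : (f i @` V `&` f j @` V) (f i (word_map w x)).
      split; first by exists (word_map w x) => //; exact: inV.
      by rewrite -[f i _]xy; exists (word_map w' y) => //; exact: inV.
    by rewrite Vdisj.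
  move: xy; rewrite ij /= => /finj yx; congr cons; apply: IH.
  by exists (word_map w x); split; [exists x|exists y].
Qed.

Lemma bigcup_word_map (L : set T) n : L = \bigcup_i (f i @` L) ->
  L `<=` \bigcup_(w : n.-tuple 'I_m) (word_map w @` L).
Proof.
move=> LE; elim: n => [|n IH] x Lx; first by exists [tuple] => //; exists x.
move: Lx; rewrite {1}LE => -[i _ [y /IH[w _ [z Lz <-]] <-]].
by exists [tuple of i :: w] => //; exists z.
Qed.

End Words.

(** * Comparing the affine images of a compact set and of a ball *)

Section Comparison.
Variables (R : realType) (d : nat).
Implicit Types (x z : 'rV[R]_d).

Lemma mulmx_coord_le x (M : 'M[R]_d) a b j :
  (forall i, `|x ord0 i| <= a) -> (forall i k, `|M i k| <= b) ->
  `|(x *m M) ord0 j| <= d%:R * (a * b).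
Proof.
move=> xa Mb; rewrite mxE (le_trans (ler_norm_sum _ _ _))//.
rewrite mulr_natl -[X in _ *+ X]card_ord -sumr_const ler_sum// => i _.
by rewrite normrM ler_pM.
Qed.

(** The point is that [C] does not depend on the affine map, only on [K], the
    ball and the doubling constant: the factor [diag_mx D *m Q] of
    [pivoted_lq] sends coordinate boxes to framed boxes exactly, and the
    remaining factor distorts coordinates by a bounded amount. *)
Lemma measure_affine_image_le (mu : {measure set (borel_rV R d) -> \bar R})
    (K : set 'rV[R]_d) (x0 : 'rV[R]_d) (r rho : R) :
  isotropic_doubling mu -> compact K ->
  (forall x, K x -> forall i, `|(x - x0) ord0 i| <= rho) -> 0 < r ->
  exists2 C : R, 0 <= C & forall (T : 'M[R]_d) (t : 'rV[R]_d), T \in unitmx ->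
   (mu (affine_map T t @` K) <= C%:E * mu (affine_map T t @` ball x0 r))%E.
Proof.
move=> [mu_fin [A A1 mu_dbl]] cK Krho r0.
(* [e] is so small that the inverse of the bounded factor maps the cube of
   size [e] into the ball; the summand [1] in [b] makes the inclusion strict.
   [N] is so large that the image of [K] fits in the box of size [N * e]. *)
pose b : R := d%:R * d.-1`!%:R + 1.
have b0 : 0 < b by rewrite ltr_wpDl// mulr_ge0.
pose e := r / b; have e0 : 0 < e by rewrite divr_gt0.
pose N := (Num.truncn (d%:R * rho / e)).+1.
exists (#|{ffun 'I_d -> 'I_(N + N).+1}|%:R * A ^+ N).
  by rewrite mulr_ge0// exprn_ge0// (le_trans ler01).
move=> T t Tu; have [P [D [Q [TE Qo D0 P1 Pdet]]]] := pivoted_lq Tu.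
have Pu : P \in unitmx by rewrite unitmxE unitfE -normr_eq0 Pdet oner_neq0.
pose l i := e * D ord0 i.
have l_gt0 i : 0 < l i by rewrite mulr_gt0// D0.
pose c := affine_map T t x0.
have affE x : affine_map T t x = affine_map Q c ((x - x0) *m P *m diag_mx D).
  by rewrite /c /affine_map -!mulmxA (mulmxA P) -TE mulmxBl addrA subrK.
apply: (le_trans (doubling_cover (N := N) (c := c)
  Qo l_gt0 A1 mu_fin mu_dbl _ _ _)) => //.
- by apply: measurable_compact; exact: affine_map_compact.
- move=> _ [x Kx <-]; exists ((x - x0) *m P *m diag_mx D) => //= i.
  rewrite mul_mx_diag mxE normrM (gtr0_norm (D0 _)) /l mulrA ler_pM2r ?D0//.
  rewrite (le_trans (mulmx_coord_le i (Krho x Kx) P1))// mulr1.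
  by rewrite -ler_pdivrMr// ltW// truncnS_gt.
rewrite lee_wpmul2l ?lee_fin//.
  by rewrite mulr_ge0// exprn_ge0// (le_trans ler01).
apply: le_measure; rewrite ?inE.
- by apply: measurable_compact; exact: framed_box_compact.
- apply: measurable_open; apply: affine_map_open => //; exact: ball_open.
move=> _ [y yl <-].
pose z : 'rV[R]_d := \row_i (y ord0 i / D ord0 i).
have ze i : `|z ord0 i| <= e.
  have /andP[y0 ye] := yl i.
  by rewrite mxE ger0_norm ?divr_ge0 ?(ltW (D0 _))// ler_pdivrMr ?D0.
exists (x0 + z *m invmx P); last first.
  rewrite affE addrAC subrr add0r mulmxKV//; congr affine_map.
  by apply/rowP => i; rewrite mul_mx_diag !mxE divfK// gt_eqF// D0.
split => // i j; rewrite ord1 /ball /= mxE opprD addrA subrr sub0r normrN.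
have Pinv := fun i j => invmx_le_fact i j P1 Pdet.
rewrite (le_lt_trans (mulmx_coord_le _ ze Pinv))//.
rewrite mulrCA /e mulrAC ltr_pdivrMr// ltr_pM2l//.
by rewrite /b ltrDl.
Qed.

End Comparison.

(** * A bounded region containing all copies *)

Section Boundedness.
Variables (R : realType) (d : nat).

(** The weight [e] takes the place of the triangle inequality: the factor
    [1 + e] can be made as close to [1] as a contraction requires. *)
Lemma sqnormD_le (u w : 'rV[R]_d) e : 0 < e ->
  sqnorm (u + w) <= (1 + e) * sqnorm u + (1 + e^-1) * sqnorm w.
Proof.
move=> e0; rewrite /sqnorm !mulr_sumr -big_split /= ler_sum// => i _.
rewrite mxE -subr_ge0; set a := u _ _; set b := w _ _.
have -> : (1 + e) * a ^+ 2 + (1 + e^-1) * b ^+ 2 - (a + b) ^+ 2 =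
    (e * a - b) ^+ 2 / e by field; rewrite gt_eqF.
by rewrite divr_ge0 ?sqr_ge0// ltW.
Qed.

Lemma contractive_sqnorm (f : 'rV[R]_d -> 'rV[R]_d) : contractive f ->
  exists2 b, 0 <= b & forall a x, b <= a -> sqnorm x <= a -> sqnorm (f x) <= a.
Proof.
case=> c /andP[c0 c1] fc; pose e := (1 - c) / 2.
have e0 : 0 < e by rewrite divr_gt0// subr_gt0.
pose q := (1 + e^-1) * sqnorm (f 0).
have q0 : 0 <= q by rewrite mulr_ge0 ?sqnorm_ge0// addr_ge0// invr_ge0 ltW.
(* With contraction factor [1 - e] and additive error [q], every radius with
   [q <= e * a] works. *)
exists (q / e); first by rewrite divr_ge0// ltW.
move=> a x; rewrite ler_pdivrMr// => qa xa.
have fx : sqnorm (f x - f 0) <= c ^+ 2 * sqnorm x.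
  have := fc x 0; rewrite subr0 -ler_sqr ?nnegrE ?mulr_ge0 ?sqrtr_ge0//.
  by rewrite exprMn !sqr_sqrtr// sqnorm_ge0.
rewrite -[f x](subrK (f 0)) (le_trans (sqnormD_le _ _ e0))// -/q.
have x0 := sqnorm_ge0 x; have a0 : 0 <= a := le_trans x0 xa.
have h1 : (1 + e) * sqnorm (f x - f 0) <= (1 + e) * (c ^+ 2 * a).
  rewrite ler_wpM2l ?addr_ge0// ?(ltW e0)// (le_trans fx)//.
  by rewrite ler_wpM2l// sqr_ge0.
(* By the choice of [e], [c = 1 - 2 * e]. *)
have h2 : (1 + e) * c ^+ 2 <= 1 - e.
  have -> : c = 1 - 2 * e by rewrite /e; field.
  have : 2 * e <= 1 by rewrite /e; lra.
  by nra.
have h3 : (1 + e) * (c ^+ 2 * a) <= (1 - e) * a by rewrite mulrA ler_wpM2r.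
nra.
Qed.

Lemma contractive_family_invariant_ball m
    (f : 'I_m -> 'rV[R]_d -> 'rV[R]_d) a0 :
  (forall i, contractive (f i)) -> 0 <= a0 ->
  exists2 a, a0 <= a & forall i x, sqnorm x <= a -> sqnorm (f i x) <= a.
Proof.
move=> fc a00; pose b i := s2val (cid2 (contractive_sqnorm (fc i))).
have b0 i : 0 <= b i by rewrite /b; case: cid2.
exists (a0 + \sum_i b i); first by rewrite lerDl sumr_ge0.
move=> i x; have : b i <= a0 + \sum_j b j.
  by rewrite (bigD1 i)//= addrCA lerDl addr_ge0// sumr_ge0.
by rewrite /b; case: cid2 => /= ? _; apply.
Qed.

Lemma measure_sqnorm_ball_fin (mu : {measure set (borel_rV R d) -> \bar R}) a :
  isotropic_doubling mu ->
  exists2 G : set 'rV[R]_d,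
      measurable (G : set (borel_rV R d)) /\ (mu G < +oo)%E &
    forall x, sqnorm x <= a -> G x.
Proof.
move=> [mu_fin _]; pose b := `|a| + 1.
pose G := @framed_box R d 1%:M (fun=> b + b) (const_mx (- b)).
have b0 : 0 < b + b by rewrite addr_gt0// /b ltr_wpDl.
exists G.
  split; first by apply: measurable_compact; exact: framed_box_compact.
  have /mu_fin/andP[] // : rectangular_box G.
  by apply: framed_box_rectangular => //; rewrite trmx1 mulmx1.
move=> x xa; exists (x + const_mx b).
  move=> i; rewrite !mxE.
  have xi : x ord0 i ^+ 2 <= a := le_trans (sqnorm_coord x i) xa.
  have aa : a <= `|a| := ler_norm a.
  by apply/andP; split; rewrite /b; nra.
by rewrite /affine_map mulmx1; apply/rowP => i; rewrite !mxE addrK.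
Qed.

End Boundedness.

(** * Conclusion *)

Lemma word_map_affine (R : realType) (d m : nat) (T : 'I_m -> 'M[R]_d)
    (t : 'I_m -> 'rV[R]_d) (w : seq 'I_m) : (forall i, T i \in unitmx) ->
  exists S s, S \in unitmx /\
    word_map (fun i => affine_map (T i) (t i)) w = affine_map S s.
Proof.
move=> Tu; elim: w => [|i w [S [s [Su IH]]]].
  exists 1%:M, 0; split; first exact: unitmx1.
  by apply/funext => x; rewrite /= /affine_map mulmx1 addr0.
exists (S *m T i), (s *m T i + t i); split; first by rewrite unitmx_mul Su Tu.
by apply/funext => x /=; rewrite IH /affine_map /= mulmxDl mulmxA addrA.
Qed.

Lemma compact_sup_bound (R : realType) d (K : set 'rV[R]_d) x0 : compact K ->
  exists rho : R, forall x, K x -> forall i, `|(x - x0) ord0 i| <= rho.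
Proof.
move=> /compact_bounded[M [_ MK]]; exists (`|x0| + (M + 1) + 1) => x Kx i.
have Mx : `|x| <= M + 1 by apply: MK => //; rewrite ltrDl.
have : ball x0 (`|x0| + (M + 1) + 1) x.
  rewrite mx_norm_ball /ball_ /= (le_lt_trans (ler_normB _ _))//.
  by rewrite (@le_lt_trans _ _ (`|x0| + (M + 1))) ?lerD2l// ltrDl.
by case=> _ /(_ ord0 i) /ltW; rewrite /ball /= !mxE distrC.
Qed.

(** Adding the bounds for the first [N] sets gives [N * mu L <= C * mu G], for
    every [N]. *)
Lemma measure0_of_disjoint_copies d (T : measurableType d) (R : realType)
    (mu : {measure set T -> \bar R}) (E : nat -> set T) (G L : set T) (C : R) :
  0 <= C -> measurable G -> (mu G < +oo)%E -> (forall n, measurable (E n)) ->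
  (forall n, E n `<=` G) -> (forall n k, E n `&` E k !=set0 -> n = k) ->
  (forall n, mu L <= C%:E * mu (E n))%E -> mu L = 0%E.
Proof.
move=> C0 mG Gfin mE EG Edisj LE.
have Gf : mu G \is a fin_num by rewrite ge0_fin_numE.
have EGle n : (mu (E n) <= mu G)%E by apply: le_measure; rewrite ?inE.
have Ef n : mu (E n) \is a fin_num.
  by rewrite ge0_fin_numE// (le_lt_trans (EGle n)).
have Lf : mu L \is a fin_num.
  rewrite ge0_fin_numE// (le_lt_trans (LE 0%N))//.
  by rewrite -(fineK (Ef 0%N)) -EFinM ltry.
pose a := fine (mu L).
have sumE N : N%:R * a <= C * fine (mu G).
  have : (\sum_(n < N) mu (E n) <= mu G)%E.
    rewrite -measure_eq_fin//.
      apply: le_measure; rewrite ?inE//.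
      - exact: fin_bigcup_measurable.
      - by move=> x [n _ /EG].
    by move=> i j _ _ /Edisj /val_inj.
  under eq_bigr do rewrite -(fineK (Ef _)).
  rewrite sumEFin -(fineK Gf) lee_fin => /(ler_wpM2l C0); apply: le_trans.
  rewrite mulr_sumr mulr_natl -[X in _ *+ X]card_ord -sumr_const.
  apply: ler_sum => n _; rewrite -lee_fin EFinM !fineK//.
apply/eqP; rewrite -(fineK Lf) eqe -/a eq_le fine_ge0// andbT leNgt.
apply/negP => a0.
have := sumE (Num.truncn (C * fine (mu G) / a)).+1.
by rewrite -ler_pdivlMr// leNgt truncnS_gt.
Qed.

Theorem theorem1p4 (R : realType) (d m : nat) (T : 'I_m -> 'M[R]_d)
    (t : 'I_m -> 'rV[R]_d) (L : set 'rV[R]_d)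
    (hd : (1 <= d)%N)
    (hT : forall i, T i \in unitmx)
    (hc : forall i, contractive (affine_map (T i) (t i)))
    (hosch : osch (fun i => affine_map (T i) (t i)))
    (hL : is_attractor (fun i => affine_map (T i) (t i)) L) :
  thin_for_isotropic_doubling L.
Proof.
move=> mu mu_dbl.
have [V [[_ Vopen fV Vdisj] [x0 /nbhs_ballP[r r0 Bhole]]]] := hosch.
have [_ cL LE] := hL.
set f := fun i => affine_map (T i) (t i) in fV Vdisj Bhole LE.
pose B := ball x0 r.
have BV : B `<=` V by move=> x /Bhole[].
have Bf i : B `&` f i @` V = set0.
  by apply/seteqP; split=> // x [/Bhole[_ nfV] fVx]; apply: nfV; exists i.
have finj i : injective (f i) by apply: can_inj; exact: affine_mapK.
have [rho Lrho] := compact_sup_bound x0 cL.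
have [C C0 muC] := measure_affine_image_le mu_dbl cL Lrho r0.
have waff w := word_map_affine t w hT.
pose a0 := \sum_i (`|x0 ord0 i| + r) ^+ 2.
have a00 : 0 <= a0 by apply: sumr_ge0 => i _; exact: sqr_ge0.
have [a a0a fa] := contractive_family_invariant_ball hc a00.
have Ba x : B x -> sqnorm x <= a.
  case=> _ Bx; apply: le_trans a0a; apply: ler_sum => i _.
  rewrite -(real_normK (num_real (x ord0 i))).
  rewrite ler_sqr ?nnegrE ?addr_ge0// ?(ltW r0)//.
  have := Bx ord0 i; rewrite /ball /= => /ltW; rewrite distrC => xr.
  have := ler_normD (x ord0 i - x0 ord0 i) (x0 ord0 i).
  by rewrite subrK => /le_trans; apply; rewrite addrC lerD2l.
have [G [mG Gfin] aG] := measure_sqnorm_ball_fin a mu_dbl.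
have wB w x : B x -> sqnorm (word_map f w x) <= a.
  by move=> Bx; elim: w => [|i w IH] /=; [exact: Ba|exact: fa].
have mwB w : measurable (word_map f w @` B : set (borel_rV R d)).
  have [S [s [Su ->]]] := waff w.
  by apply: measurable_open; apply: affine_map_open => //; exact: ball_open.
pose E n : set (borel_rV R d) :=
  \bigcup_(w : n.-tuple 'I_m) (word_map f w @` B).
have wdisj := word_map_disjoint finj fV Vdisj BV Bf.
apply: (measure0_of_disjoint_copies (mu := mu) (E := E) C0 mG Gfin).
- by move=> n; apply: fin_bigcup_measurable.
- by move=> n _ [w _ [x Bx <-]]; apply: aG; exact: wB.
- move=> n k [x [[w _ wx] [w' _ w'x]]].
  by rewrite -(size_tuple w) -(size_tuple w') (wdisj w w')//; exists x.
move=> n; rewrite /E measure_eq_fin//; last first.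
  by move=> w w' _ _ /wdisj/val_inj.
rewrite ge0_sume_distrr//.
apply: le_trans (measure_le_fin mu
  (F := fun w : n.-tuple 'I_m => word_map f w @` L) _ _ _) _.
- move=> w; have [S [s [Su ->]]] := waff w.
  by apply: measurable_compact; exact: affine_map_compact.
- exact: measurable_compact.
- exact: bigcup_word_map.
apply: lee_sum => w _; have [S [s [Su ->]]] := waff w.
exact: muC.
Qed.
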